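(* The axiom system $\mathsf{EKB}$ is sound and complete for $\mathcal{L}_{E,K,B}$ with respect to the class of relational doxastic evidence models: a formula is a theorem of $\mathsf{EKB}$ if and only if it is true at every point of every relational doxastic evidence model.
   Context: $\mathcal{L}_{E,K,B}$ is generated by $\phi ::= p \mid \neg\phi \mid \phi\wedge\psi \mid E\phi \mid K\phi \mid B\phi$. A relational doxastic evidence model is $M=(X,R_E,R_B,v)$ with $X$ nonempty, $R_E$ a reflexive binary relation on $X$, $R_B$ a binary relation on $X$ such that for all $x,y\in X$, $R_B(x)\neq\emptyset$ and $R_B(x)=R_B(y)$ (where $R(x)=\{y : xRy\}$), and $v:\textsc{prop}\to 2^X$. Truth: $p$ via $v$; Booleans as usual; $M,x\models E\phi$ iff $R_E(x)\subseteq\|\phi\|_M$; $M,x\models K\phi$ iff $\|\phi\|_M=X$; $M,x\models B\phi$ iff $R_B(x)\subseteq\|\phi\|_M$, where $\|\phi\|_M=\{x : M,x\models\phi\}$. $\mathsf{EKB}$ consists of: classical propositional logic with modus ponens; $\mathsf{S5}$ for $K$ (axioms $K(\phi\to\psi)\to(K\phi\to K\psi)$, $K\phi\to\phi$, $K\phi\to KK\phi$, $\neg K\phi\to K\neg K\phi$, necessitation); $\mathsf{KT}$ for $E$ ($E(\phi\to\psi)\to(E\phi\to E\psi)$, $E\phi\to\phi$, necessitation); $K\phi\to E\phi$; $B(\phi\to\psi)\to(B\phi\to B\psi)$; $B\phi\to\neg B\neg\phi$; $B\phi\to KB\phi$; $K\phi\to B\phi$. *)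

(* Defs.v *)
From mathcomp Require Import all_boot boolp classical_sets.

Set Implicit Arguments.
Unset Strict Implicit.
Unset Printing Implicit Defensive.

Local Open Scope classical_set_scope.

Inductive form (atom : Type) : Type :=
| Atom of atom
| Neg of form atom
| And of form atom & form atom
| Ebox of form atom
| Kbox of form atom
| Bbox of form atom.

Definition Imp (atom : Type) (phi psi : form atom) : form atom :=
  Neg (And phi (Neg psi)).

(* A relation R is represented by its successor map x |-> R(x). *)
Record model (atom : Type) : Type := Model {
  world :> Type;
  RE : world -> set world;
  RB : world -> set world;
  valuation : atom -> set world;
  world_nonempty : [set: world] !=set0;
  RE_refl : forall x, RE x x;
  RB_nonempty : forall x, RB x !=set0;
  RB_const : forall x y, RB x = RB y
}.

Fixpoint sat (atom : Type) (M : model atom) (x : M) (phi : form atom) : Prop :=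
  match phi with
  | Atom p => valuation p x
  | Neg psi => ~ sat x psi
  | And psi chi => sat x psi /\ sat x chi
  | Ebox psi => RE x `<=` [set y | sat y psi]
  | Kbox psi => [set y : M | sat y psi] = setT
  | Bbox psi => RB x `<=` [set y | sat y psi]
  end.

Definition valid (atom : Type) (phi : form atom) : Prop :=
  forall (M : model atom) (x : M), sat x phi.

(* V assigns truth values to all formulas, so that atoms and modal formulas
   alike play the role of propositional letters: the tautologies are exactly
   the substitution instances of classical propositional tautologies. *)
Definition tautology (atom : Type) (phi : form atom) : Prop :=
  forall V : form atom -> bool,
    (forall psi, V (Neg psi) = ~~ V psi) ->
    (forall psi chi, V (And psi chi) = V psi && V chi) ->
    V phi.

Inductive EKB (atom : Type) : form atom -> Prop :=
| EKB_taut phi : tautology phi -> EKB phi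
| EKB_mp phi psi : EKB (Imp phi psi) -> EKB phi -> EKB psi
| EKB_K_dist phi psi :
    EKB (Imp (Kbox (Imp phi psi)) (Imp (Kbox phi) (Kbox psi)))
| EKB_K_fact phi : EKB (Imp (Kbox phi) phi)
| EKB_K_pos phi : EKB (Imp (Kbox phi) (Kbox (Kbox phi)))
| EKB_K_neg phi : EKB (Imp (Neg (Kbox phi)) (Kbox (Neg (Kbox phi))))
| EKB_K_nec phi : EKB phi -> EKB (Kbox phi)
| EKB_E_dist phi psi :
    EKB (Imp (Ebox (Imp phi psi)) (Imp (Ebox phi) (Ebox psi)))
| EKB_E_fact phi : EKB (Imp (Ebox phi) phi)
| EKB_E_nec phi : EKB phi -> EKB (Ebox phi)
| EKB_KE phi : EKB (Imp (Kbox phi) (Ebox phi))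
| EKB_B_dist phi psi :
    EKB (Imp (Bbox (Imp phi psi)) (Imp (Bbox phi) (Bbox psi)))
| EKB_B_cons phi : EKB (Imp (Bbox phi) (Neg (Bbox (Neg phi))))
| EKB_B_intro phi : EKB (Imp (Bbox phi) (Kbox (Bbox phi)))
| EKB_KB phi : EKB (Imp (Kbox phi) (Bbox phi)).

(* Main.v *)
(* Completeness is by a canonical model. Given an unprovable phi, take a maximal
   theory G0 omitting it, obtained from Zorn's lemma as the atoms may be
   uncountable. The worlds are the maximal theories containing every psi with
   K psi in G0; by S5 they contain the same formulas K psi, hence, by
   B psi -> K B psi, the same formulas B psi. Thus K is interpreted by the
   universal relation, and the doxastic successors, read off from G0 alone,
   do not depend on the world. *)
Require Import Defs.
From mathcomp Require Import all_boot boolp classical_sets.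

Set Implicit Arguments.
Unset Strict Implicit.
Unset Printing Implicit Defensive.

Local Open Scope classical_set_scope.

Lemma sat_Imp (atom : Type) (M : model atom) (x : M) (phi psi : form atom) :
  sat x (Imp phi psi) <-> (sat x phi -> sat x psi).
Proof.
split=> [/= h hp|h /= [/h]]; last by [].
by apply: contrapT => hn; apply: h.
Qed.

Lemma tautology_sat (atom : Type) (M : model atom) (x : M) (phi : form atom) :
  tautology phi -> sat x phi.
Proof.
(* Truth at [x], turned into a boolean, is itself an admissible assignment. *)
move=> /(_ (fun psi => `[< sat x psi >])) taut; apply/asboolP; apply: taut.
- by move=> psi; rewrite /= asbool_neg.
- by move=> psi chi; rewrite /= asbool_and.
Qed.

Lemma EKB_sound (atom : Type) (phi : form atom) : EKB phi -> valid phi.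
Proof.
elim=> {phi} [phi taut|phi psi _ IHi _ IH|phi psi|phi|phi|phi|phi _ IH|phi psi
  |phi|phi _ IH|phi|phi psi|phi|phi|phi] M x; rewrite ?sat_Imp.
- exact: tautology_sat.
- by have /sat_Imp := IHi M x; apply.
- move=> /= h hp; apply/seteqP; split=> // y _ /=.
  have /sat_Imp : [set y | sat y (Imp phi psi)] y by rewrite h.
  by apply; have : [set y | sat y phi] y by rewrite hp.
- by move=> /= h; have : [set y | sat y phi] x by rewrite h.
- by move=> /= h; apply/seteqP; split.
- by move=> /= h; apply/seteqP; split.
- by apply/seteqP; split=> // y _; apply: IH.
- by move=> h hp y xy; have /sat_Imp := h y xy; apply; apply: hp.
- by move=> /=; apply; apply: RE_refl.
- by move=> y _; apply: IH.
- by move=> /= h y _; rewrite h.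
- by move=> h hp y xy; have /sat_Imp := h y xy; apply; apply: hp.
(* Consistency of belief rests on a nonempty successor set; in the next case, introspection rests on
   its constancy. *)
- by move=> h hn; have [y xy] := RB_nonempty x; apply: (hn y xy); apply: h.
- by move=> h; apply/seteqP; split=> // y _ /=; rewrite (RB_const y x).
- by move=> /= h y _; rewrite h.
Qed.

Ltac tauto_EKB :=
  let V := fresh "V" in let VN := fresh "VN" in let VA := fresh "VA" in
  apply: EKB_taut; intros V VN VA; rewrite /Imp !(VN, VA);
  repeat match goal with |- context [V ?f] => case: (V f) end; by [].

(* Necessitation is not available from hypotheses. *)
Inductive entails (atom : Type) (G : set (form atom)) : form atom -> Prop :=
| entails_thm phi : EKB phi -> entails G phi
| entails_hyp phi : G phi -> entails G phi
| entails_mp phi psi :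
    entails G (Imp phi psi) -> entails G phi -> entails G psi.

(** The equivalence for [Neg] packs consistency and negation completeness together. *)
Definition maximal (atom : Type) (G : set (form atom)) : Prop :=
  (forall phi, entails G phi -> G phi) /\
  (forall phi, G (Neg phi) <-> ~ G phi).

Section Entailment.
Variable atom : Type.
Implicit Types (phi psi chi : form atom) (G D X : set (form atom)).

Lemma entails_mono G D phi : G `<=` D -> entails G phi -> entails D phi.
Proof.
move=> GD; elim=> {phi} [phi h|phi h|phi psi _ IHi _ IH].
- exact: entails_thm.
- by apply: entails_hyp; apply: GD.
- exact: entails_mp IHi IH.
Qed.

Lemma entails0 phi : entails set0 phi -> EKB phi.
Proof. by elim=> {phi} [//|//|phi psi _ IHi _ IH]; apply: EKB_mp IHi IH. Qed.

Lemma deduction G phi psi :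
  entails (phi |` G) psi -> entails G (Imp phi psi).
Proof.
elim=> {psi} [psi h|psi [->|h]|psi chi _ IHi _ IH].
- apply: entails_mp (entails_thm _ h); apply: entails_thm; tauto_EKB.
- by apply: entails_thm; tauto_EKB.
- apply: entails_mp (entails_hyp h); apply: entails_thm; tauto_EKB.
- apply: entails_mp IH; apply: entails_mp IHi.
  apply: entails_thm; tauto_EKB.
Qed.

(** Compactness along a chain: at each modus ponens the larger of the two members serves both
    premises. The member [set0] covers derivations that use no hypothesis from the chain. *)
Lemma entails_bigcup G (F : set (set (form atom))) phi :
  total_on F subset -> F set0 ->
  entails (G `|` \bigcup_(X in F) X) phi ->
  exists2 X, F X & entails (G `|` X) phi.
Proof.
move=> Ftot F0; elim=> {phi} [phi h|phi [h|[X FX h]]|].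
- by exists set0 => //; apply: entails_thm.
- by exists set0 => //; apply: entails_hyp; left.
- by exists X => //; apply: entails_hyp; right.
move=> phi psi _ [X FX hX] _ [Y FY hY].
have [XY|YX] := Ftot X Y FX FY.
- exists Y => //; apply: entails_mp hY.
  by apply: entails_mono hX; apply: setUS.
- exists X => //; apply: entails_mp hX _.
  by apply: entails_mono hY; apply: setUS.
Qed.

(** Zorn's lemma is applied to the sets [X] such that [G] together with [X] does not entail [phi];
    [D] is [G] joined with a maximal such [X]. *)
Lemma lindenbaum G phi : ~ entails G phi ->
  exists D, [/\ maximal D, G `<=` D & ~ D phi].
Proof.
move=> Gphi.
pose P X := ~ entails (G `|` X) phi.
have [F FP Ftot|A [PA Amax]] := @Zorn_bigcup _ P.
  move=> h.
  (* The chain need not contain [set0]; adjoining it leaves a chain. *)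
  have [||| X [->|FX]] := @entails_bigcup G (set0 |` F) phi.
  - by move=> X Y [->|FX] [->|FY]; [left|left|right|apply: Ftot].
  - by left.
  - apply: entails_mono h; apply: setUS => psi [X FX Xpsi].
    by exists X => //; right.
  - by rewrite setU0.
  - exact: FP.
(* By maximality, adding a missing [psi] makes [phi] derivable; the deduction theorem discharges
   [psi]. *)
have imp_phi psi : ~ (G `|` A) psi -> entails (G `|` A) (Imp psi phi).
  move=> npsi; apply: deduction; rewrite setUCA; apply: contrapT.
  apply: Amax; split; first by move=> chi; right.
  by move=> /(_ psi) h; apply: npsi; right; apply: h; left.
have Gclosed psi : entails (G `|` A) psi -> (G `|` A) psi.
  by move=> h; apply: contrapT => /imp_phi hi; apply: PA; apply: entails_mp hi h.
exists (G `|` A); split; [split=> // psi|by left|by move=> /entails_hyp].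
split=> [hn hp|hp].
- apply: PA; apply: entails_mp (entails_hyp hn).
  apply: entails_mp (entails_hyp hp); apply: entails_thm; tauto_EKB.
(* Were [psi] and [Neg psi] both missing, each would imply [phi], so [phi] would follow by cases. *)
- apply: contrapT => hn; apply: PA.
  apply: entails_mp (imp_phi _ hp); apply: entails_mp (imp_phi _ hn).
  apply: entails_thm; tauto_EKB.
Qed.

Lemma maximal_mp G phi psi : maximal G -> EKB (Imp phi psi) -> G phi -> G psi.
Proof.
move=> [Gclosed _] hi h; apply: Gclosed.
exact: entails_mp (entails_thm _ hi) (entails_hyp h).
Qed.

Lemma maximal_and G phi psi : maximal G -> G (And phi psi) <-> G phi /\ G psi.
Proof.
move=> Gmax; split=> [h|[hp hq]].
  by split; apply: maximal_mp Gmax _ h; tauto_EKB.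
case: Gmax => Gclosed _; apply: Gclosed; apply: entails_mp (entails_hyp hq).
apply: entails_mp (entails_hyp hp); apply: entails_thm; tauto_EKB.
Qed.

(** The derivation is boxed step by step: necessitation treats its theorems, distribution its uses
    of modus ponens. An arbitrary normal [box] covers E, K and B at once. *)
Lemma maximal_box (box : form atom -> form atom) G phi :
  (forall psi, EKB psi -> EKB (box psi)) ->
  (forall psi chi, EKB (Imp (box (Imp psi chi)) (Imp (box psi) (box chi)))) ->
  maximal G -> entails [set psi | G (box psi)] phi -> G (box phi).
Proof.
move=> nec dist [Gclosed _].
elim=> {phi} [phi h|//|phi psi _ IHi _ IH]; apply: Gclosed.
  by apply: entails_thm; apply: nec.
apply: entails_mp (entails_hyp IH); apply: entails_mp (entails_hyp IHi).
exact: entails_thm.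
Qed.

Lemma EKB_B_nec phi : EKB phi -> EKB (Bbox phi).
Proof. by move=> h; apply: EKB_mp (EKB_KB _) (EKB_K_nec h). Qed.

End Entailment.

Section CanonicalModel.
Variables (atom : Type) (G0 : set (form atom)).
Hypothesis G0max : maximal G0.
Implicit Types (phi psi : form atom).

Definition canonical_world : Type :=
  {G : set (form atom) | maximal G /\ forall psi, G0 (Kbox psi) -> G psi}.

Definition theory (x : canonical_world) : set (form atom) := sval x.

Definition canonical_RE (x : canonical_world) : set canonical_world :=
  [set y | forall psi, theory x (Ebox psi) -> theory y psi].

Definition canonical_RB (x : canonical_world) : set canonical_world :=
  [set y | forall psi, G0 (Bbox psi) -> theory y psi].

Lemma theory_maximal x : maximal (theory x).
Proof. exact: (svalP x).1. Qed.

Lemma theory_K x psi : G0 (Kbox psi) -> theory x psi.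
Proof. exact: (svalP x).2. Qed.

Definition root : canonical_world :=
  exist _ G0 (conj G0max (fun psi => maximal_mp G0max (EKB_K_fact psi))).

Lemma Kbox_const x psi : theory x (Kbox psi) <-> G0 (Kbox psi).
Proof.
split=> [xK|h]; last first.
  by apply: theory_K; apply: maximal_mp G0max (EKB_K_pos _) h.
(* Negative introspection in [G0] sends the absence of [Kbox psi] to every world. *)
apply: contrapT => /(G0max.2 _).2 /(maximal_mp G0max (EKB_K_neg _)).
by move=> /(theory_K x) /(theory_maximal x).2.
Qed.

Lemma Bbox_const x psi : theory x (Bbox psi) <-> G0 (Bbox psi).
Proof.
split=> [h|h]; last first.
  by apply: theory_K; apply: maximal_mp G0max (EKB_B_intro _) h.
(* The transfer from [x] back to [G0] goes through [Kbox (Bbox psi)], on which all worlds agree. *)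
apply: (theory_K root); apply/(Kbox_const x).
exact: maximal_mp (theory_maximal x) (EKB_B_intro _) h.
Qed.

(** Existence lemma for all three modalities. Since K implies [box], the maximal theory built from
    the boxed formulas of [x] contains whatever [G0] knows, hence is a world. *)
Lemma world_omitting (box : form atom -> form atom) x phi :
  (forall psi, EKB psi -> EKB (box psi)) ->
  (forall psi chi, EKB (Imp (box (Imp psi chi)) (Imp (box psi) (box chi)))) ->
  (forall psi, EKB (Imp (Kbox psi) (box psi))) ->
  ~ theory x (box phi) ->
  exists y, (forall psi, theory x (box psi) -> theory y psi) /\ ~ theory y phi.
Proof.
move=> nec dist Kbox_box xphi.
have [|G [Gmax sub Gphi]] := @lindenbaum _ [set psi | theory x (box psi)] phi.
  by move=> /(maximal_box nec dist (theory_maximal x)).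
have GK psi : G0 (Kbox psi) -> G psi.
  by move=> /(Kbox_const x) /(maximal_mp (theory_maximal x) (Kbox_box _)) /sub.
by exists (exist _ G (conj Gmax GK)).
Qed.

Lemma canonical_RE_refl x : canonical_RE x x.
Proof. by move=> psi; apply: maximal_mp (theory_maximal x) (EKB_E_fact _). Qed.

Lemma canonical_RB_nonempty x : canonical_RB x !=set0.
Proof.
(* Without atoms there are no formulas at all, and the successor condition is vacuous. *)
have [[phi]|none] := pselect (inhabited (form atom)); last first.
  by exists root => psi; case: none.
(* Any disbelieved formula yields a successor; the negation of a tautology is one, by consistency of
   B. *)
have nBn : ~ theory root (Bbox (Neg (Imp phi phi))).
  apply/(theory_maximal root).2; apply: maximal_mp G0max (EKB_B_cons _) _.
  apply: G0max.1; apply: entails_thm; apply: EKB_B_nec; tauto_EKB.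
have [y [xy _]] := world_omitting (@EKB_B_nec _) (@EKB_B_dist _) (@EKB_KB _) nBn.
by exists y.
Qed.

Definition canonical_model : model atom :=
  @Model atom canonical_world canonical_RE canonical_RB
    (fun p => [set x | theory x (Atom p)]) (ex_intro _ root I)
    canonical_RE_refl canonical_RB_nonempty (fun _ _ => erefl).

Lemma truth phi (x : canonical_model) : sat x phi <-> theory x phi.
Proof.
elim: phi x => [p|phi IH|phi IH psi IH'|phi IH|phi IH|phi IH] x //=.
- by rewrite IH (theory_maximal x).2.
- by rewrite IH IH' (maximal_and _ _ (theory_maximal x)).
- split=> [h|h y xy]; last by apply/IH; apply: xy.
  apply: contrapT.
  move=> /(world_omitting (@EKB_E_nec _) (@EKB_E_dist _) (@EKB_KE _)).
  by move=> [y [xy yphi]]; apply: yphi; apply/IH; apply: h.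
- split=> [h|/Kbox_const h]; last first.
    by apply/seteqP; split=> // y _; apply/IH; apply: theory_K.
  apply: contrapT.
  (* Here [box] is K itself; the relation to [x] is then dropped, as K ranges over all worlds. *)
  have triv psi : EKB (Imp (Kbox psi) (Kbox psi)) by tauto_EKB.
  move=> /(world_omitting (@EKB_K_nec _) (@EKB_K_dist _) triv).
  move=> [y [_ yphi]]; apply: yphi; apply/IH.
  by have : [set y : canonical_model | sat y phi] y by rewrite h.
- split=> [h|/Bbox_const h y xy]; last by apply/IH; apply: xy.
  apply: contrapT.
  move=> /(world_omitting (@EKB_B_nec _) (@EKB_B_dist _) (@EKB_KB _)).
  move=> [y [xy yphi]]; apply: yphi; apply/IH; apply: h => psi /(Bbox_const x).
  exact: xy.
Qed.

End CanonicalModel.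

Theorem theorem4 (atom : Type) (phi : form atom) : EKB phi <-> valid phi.
Proof.
split; first exact: EKB_sound.
move=> phi_valid; apply: contrapT => nphi.
have [|G [Gmax _ Gphi]] := @lindenbaum _ set0 phi; first by move=> /entails0.
by have /truth := phi_valid (canonical_model Gmax) (root Gmax).
Qed.
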